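(* Let $\mathfrak{V}\subseteq\mathbb{D}_Q\subset\mathbb{M}^d$ be any subvariety of a nc operator ball $\mathbb{D}_Q$. Then $\mathfrak{V}$ is matrix-spanning if and only if there are no nonzero linear homogeneous free nc polynomials (i.e. polynomials $\sum_{j=1}^d c_jZ_j$, $c_j\in\mathbb{C}$, not all zero) in $I(\mathfrak{V})$.
   Context: $M_n^d$ is the set of $d$-tuples of complex $n\times n$ matrices ($M_n=M_n^1$), identified with $\mathbb{C}^d\otimes M_n$; $\mathbb{M}^d=\sqcup_{n\ge1}M_n^d$; for $\Omega\subseteq\mathbb{M}^d$, $\Omega(n)=\Omega\cap M_n^d$. A nc function $f:\Omega\to\mathbb{M}^1$ on a set $\Omega$ closed under direct sums is a graded map ($X\in\Omega(n)\Rightarrow f(X)\in M_n$) with $f(X\oplus Y)=f(X)\oplus f(Y)$ and $f(S^{-1}XS)=S^{-1}f(X)S$ whenever $S\in GL_n$ and $X,S^{-1}XS\in\Omega(n)$. NC operator ball: given Hilbert spaces $\mathcal{R},\mathcal{S}$ and linearly independent $Q_1,\dots,Q_d\in\mathcal{L}(\mathcal{R},\mathcal{S})$, put $Q(X)=\sum_jQ_j\otimes X_j$ for $X\in\mathbb{M}^d$ and $\mathbb{D}_Q=\{X\in\mathbb{M}^d:\|Q(X)\|<1\}$. $H^\infty(\mathbb{D}_Q)$ is the algebra of bounded nc functions $\mathbb{D}_Q\to\mathbb{M}^1$. A subvariety of $\mathbb{D}_Q$ is a set $\mathfrak{V}=\{X\in\mathbb{D}_Q: f(X)=0\ \forall f\in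 S\}$ with $S\subseteq H^\infty(\mathbb{D}_Q)$. $I(\mathfrak{V})$ is the ideal of functions in $H^\infty(\mathbb{D}_Q)$ vanishing on $\mathfrak{V}$. $\operatorname{mat-span}\mathfrak{V}(n)=\operatorname{span}\{[I_d\otimes T]X: X\in\mathfrak{V}(n),\ T\in\mathcal{L}(M_n)\}$, where $[I_d\otimes T]X=(T(X_1),\dots,T(X_d))$. $\mathfrak{V}$ is matrix-spanning if $\operatorname{mat-span}\mathfrak{V}(n)=\mathbb{C}^d\otimes M_n$ for some $n\in\mathbb{N}$. *)

(* Defs.v *)
From HB Require Import structures.
From mathcomp Require Import all_boot all_order all_algebra.
From mathcomp Require Import all_classical all_reals all_analysis.
From mathcomp Require Export complex.

Set Implicit Arguments.
Unset Strict Implicit.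
Unset Printing Implicit Defensive.

Import Order.TTheory GRing.Theory Num.Theory.
Import numFieldNormedType.Exports.
Local Open Scope classical_set_scope.
Local Open Scope ring_scope.

(* The inner product is linear in its first argument and conjugate-linear in
   the second one. *)
Record hilbertType (R : realType) := Hilbert {
  hilbert_sort :> completeNormedModType R[i];
  hdot : {dot hilbert_sort for Num.conj};
  hnormE : forall u : hilbert_sort, `|u| ^+ 2 = hdot u u }.

Section LinearSpan.
Variables (K : pzRingType) (U : lmodType K).

Definition lspan (A : set U) : set U :=
  [set u | exists (k : nat) (c : 'I_k -> K) (w : 'I_k -> U),
      (forall i, A (w i)) /\ u = \sum_i c i *: w i].

End LinearSpan.

Section OperatorNorm.
Variable R : realType.

(* The Hilbert space H (x) C^n is represented by 'I_n -> H. The norm of a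
   normed space over R[i] takes its values in R[i]; its real part is used. *)
Definition l2norm n (H : normedZmodType R[i]) (v : 'I_n -> H) : R :=
  Num.sqrt (\sum_i complex.Re `|v i| ^+ 2).

Definition opnorm n m (H K : normedZmodType R[i])
    (T : ('I_n -> H) -> ('I_m -> K)) : \bar R :=
  ereal_sup [set (l2norm (T v))%:E | v in [set v | l2norm v <= 1]].

(* The library norm on 'M_n is the maximum of the moduli of the entries; the
   norm used here is the one of operators on C^n. *)
Definition mxopnorm n (A : 'M[R[i]]_n) : \bar R :=
  opnorm (fun (v : 'I_n -> R[i]) i => \sum_k A i k * v k).

End OperatorNorm.

Section NCFunctions.
Variables (R : realType) (d : nat).

Definition mtuple n := {ffun 'I_d -> 'M[R[i]]_n}.

(* Graded subsets of the nc universe. The level n = 0, which is not part of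
   the nc universe, exists in the type, but is empty for nc operator balls and
   their subvarieties. *)
Definition ncset := forall n, set (mtuple n).

(* Graded maps. The values of a nc function outside of its domain are
   irrelevant. *)
Definition ncmap := forall n, mtuple n -> 'M[R[i]]_n.

Definition nc_dsum n m (X : mtuple n) (Y : mtuple m) : mtuple (n + m) :=
  [ffun j => block_mx (X j) 0 0 (Y j)].

Definition nc_conj n (S : 'M[R[i]]_n) (X : mtuple n) : mtuple n :=
  [ffun j => invmx S *m X j *m S].

(* For domains Omega that are closed under direct sums. *)
Definition nc_function (Omega : ncset) (f : ncmap) : Prop :=
  (forall n m (X : mtuple n) (Y : mtuple m), Omega n X -> Omega m Y ->
     f (n + m)%N (nc_dsum X Y) = block_mx (f n X) 0 0 (f m Y)) /\
  (forall n (S : 'M[R[i]]_n) (X : mtuple n), S \in unitmx ->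
     Omega n X -> Omega n (nc_conj S X) ->
     f n (nc_conj S X) = invmx S *m f n X *m S).

Definition nc_Hinfty (Omega : ncset) : set ncmap :=
  [set f | nc_function Omega f /\
     exists M : R, forall n (X : mtuple n),
       Omega n X -> (mxopnorm (f n X) <= M%:E)%E].

Definition nc_subvariety (Omega V : ncset) : Prop :=
  exists2 S : set ncmap, S `<=` nc_Hinfty Omega &
    forall n, V n = [set X | Omega n X /\ forall f, S f -> f n X = 0].

Definition nc_ideal (Omega V : ncset) : set ncmap :=
  [set f | nc_Hinfty Omega f /\ forall n X, V n X -> f n X = 0].

Definition nc_linear_poly (c : 'rV[R[i]]_d) : ncmap :=
  fun n X => \sum_j c 0 j *: X j.

Definition mat_span (V : ncset) n : set (mtuple n) :=
  lspan [set Y : mtuple n |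
    exists (X : mtuple n) (T : {linear 'M[R[i]]_n -> 'M[R[i]]_n}),
      V n X /\ Y = [ffun j => T (X j)]].

Definition matrix_spanning (V : ncset) : Prop :=
  exists2 n, (0 < n)%N & @mat_span V n = [set: mtuple n].

End NCFunctions.

Section OperatorBall.
Variables (R : realType) (d : nat) (H K : hilbertType R).

Definition operators_free (Q : 'I_d -> {linear H -> K}) : Prop :=
  forall c : 'rV[R[i]]_d,
    (forall u : H, \sum_j c 0 j *: Q j u = 0) -> c = 0.

(* \sum_j Q_j (x) X_j, as an operator from H (x) C^n to K (x) C^n. *)
Definition pencil (Q : 'I_d -> {linear H -> K}) n (X : mtuple R d n)
    (v : 'I_n -> H) : 'I_n -> K :=
  fun i => \sum_j \sum_k X j i k *: Q j (v k).

Definition nc_ball (Q : 'I_d -> {linear H -> K}) : ncset R d :=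
  fun n => [set X | (0 < n)%N /\ (opnorm (pencil Q X) < 1%:E)%E].

End OperatorBall.

(* Main.v *)
From HB Require Import structures.
Require Import Defs.
From mathcomp Require Import all_boot all_order all_algebra.
From mathcomp Require Import all_classical all_reals all_analysis.
From mathcomp Require Import ring lra.
Set Implicit Arguments.
Unset Strict Implicit.
Unset Printing Implicit Defensive.
Import Order.TTheory GRing.Theory Num.Theory.
Import numFieldNormedType.Exports.
Local Open Scope ring_scope.
Local Open Scope classical_set_scope.

(* A linear polynomial vanishing on V(n) vanishes on mat-span V(n), which gives
   the direct implication. Conversely, let A_n in C^d be the set of the vectors
   (X_1(a,b), ..., X_d(a,b)) with X in V(n). A linear polynomial c vanishes on
   V if and only if c annihilates all the A_n, so if there is no such c <> 0,
   the union of the A_n spans C^d. Since V is closed under direct sums, the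
   family of the A_n is directed, hence a single A_n spans C^d, and then
   mat-span V(n) is everything. That c is in H^oo of the ball follows from the
   linear independence of the Q_j: the vectors (<Q_j u, y>)_j span C^d, and
   the polynomial given by such a vector is bounded by |u| |y| on the ball. *)

(** * Linear spans, the annihilator criterion and directed unions *)

Section LinearSpan.
Variables (F : fieldType) (U : lmodType F).
Implicit Type A : set U.

Lemma sub_lspan A : A `<=` lspan A.
Proof.
move=> u Au; exists 1%N, (fun=> 1), (fun=> u); split=> //.
by rewrite big_ord1 scale1r.
Qed.

Lemma lspan0 A : lspan A 0.
Proof. by exists 0%N, (fun=> 0), (fun=> 0); split=> [[]//|]; rewrite big_ord0. Qed.

Lemma lspanZ A a u : lspan A u -> lspan A (a *: u).
Proof.
move=> [k [c [w [Aw ->]]]]; exists k, (fun i => a * c i), w; split=> //.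
by rewrite scaler_sumr; apply: eq_bigr => i _; rewrite scalerA.
Qed.

Lemma lspanD A u v : lspan A u -> lspan A v -> lspan A (u + v).
Proof.
move=> [k [c [w [Aw ->]]]] [l [b [z [Az ->]]]].
exists (k + l)%N, (fun i => match fintype.split i with inl j => c j | inr j => b j end),
  (fun i => match fintype.split i with inl j => w j | inr j => z j end); split=> [i|].
  by case: (fintype.split i).
rewrite big_split_ord /=; congr (_ + _); apply: eq_bigr => i _.
  by rewrite (unsplitK (inl i)).
by rewrite (unsplitK (inr i)).
Qed.

Lemma lspan_sum A (I : Type) (r : seq I) (P : pred I) (f : I -> U) :
  (forall i, P i -> lspan A (f i)) -> lspan A (\sum_(i <- r | P i) f i).
Proof. by move=> Af; elim/big_ind: _ => //; [exact: lspan0|exact: lspanD]. Qed.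

Lemma lspanS A B : A `<=` lspan B -> lspan A `<=` lspan B.
Proof.
move=> AB u [k [c [w [Aw ->]]]]; apply: lspan_sum => i _.
by apply: lspanZ; apply: AB.
Qed.

Lemma lspan_ind A (P : U -> Prop) :
    P 0 -> (forall u v, P u -> P v -> P (u + v)) ->
    (forall a u, P u -> P (a *: u)) -> A `<=` P -> lspan A `<=` P.
Proof.
move=> P0 PD PZ AP u [k [c [w [Aw ->]]]].
by elim/big_ind: _ => // i _; apply: PZ; apply: AP.
Qed.

End LinearSpan.

(** A matrix of maximal rank with rows in the span of A has all of A in its row space, so a vector
    that kills its rows kills A. The pairing is bilinear, without conjugation, to match the
    coefficients of linear polynomials. *)
Lemma lspan_rV_full (F : fieldType) d (A : set 'rV[F]_d) :
    (forall c : 'rV_d,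
      (forall w, A w -> \sum_j c 0 j * w 0 j = 0) -> c = 0) ->
  lspan A = setT.
Proof.
move=> Afree.
pose P r := `[< exists m (M : 'M[F]_(m, d)),
  (forall i, lspan A (row i M)) /\ \rank M = r >].
have exP : exists r, P r.
  by exists (\rank (0 : 'M[F]_(0, d))); apply/asboolP; exists 0%N, 0; split=> [[]|].
have ubP r : P r -> (r <= d)%N.
  by move=> /asboolP[m [M [_ <-]]]; apply: rank_leq_col.
case: (ex_maxnP exP ubP) => r /asboolP[m [M [AM rM]]] maxr.
have sub_span n (N : 'M[F]_(n, d)) (w : 'rV_d) : (forall i, lspan A (row i N)) ->
    (w <= N)%MS -> lspan A w.
  move=> AN /submxP[x ->]; rewrite mulmx_sum_row.
  by apply: lspan_sum => i _; apply: lspanZ.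
have AleM w : A w -> (w <= M)%MS.
  (* Appending w as a row cannot raise the maximal rank, so w adds nothing to the row space of M. *)
  move=> Aw; suff /maxr: P (\rank (col_mx M w)).
    rewrite -rM -addsmxE => leMw.
    have := mxrank_leqif_eq (addsmxSl M w); rewrite /leqif => -[_].
    have -> : (\rank M == \rank (M + w)%MS) = true.
      by rewrite eqn_leq leMw mxrankS ?addsmxSl.
    by move=> /esym /andP[_]; rewrite addsmx_sub => /andP[].
  apply/asboolP; exists (m + 1)%N, (col_mx M w); split=> // i.
  rewrite -(splitK i); case: (fintype.split _) => j /=.
    by rewrite rowKu; apply: AM.
  by rewrite rowKd row_id; apply: sub_lspan.
suff fullM : row_full M.
  by apply/seteqP; split=> // w _; apply: (sub_span m M) => //; apply: submx_full.
rewrite /row_full -mxrank_tr -/(row_free _) -kermx_eq0; apply: contraT => kn0.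
have /rowV0Pn[c cker cn0] := kn0.
suff c0 : c = 0 by rewrite c0 eqxx in cn0.
apply: Afree => w /AleM /submxP[x ->].
have /sub_kermxP cM := cker.
have : (c *m (x *m M)^T) 0 0 = 0 by rewrite trmx_mul mulmxA cM mul0mx mxE.
by rewrite mxE => cw0; rewrite -[RHS]cw0; apply: eq_bigr => j _; rewrite [in RHS]mxE.
Qed.

(** Induction on k: directedness merges an index good for the first k points with one good for the
    last point. The index [i0] serves the empty family. *)
Lemma directed_bigcup_finite (T : Type) (I : Type) (i0 : I) (B : I -> set T)
    (Bdir : forall i j, exists k, B i `<=` B k /\ B j `<=` B k)
    k (w : 'I_k -> T) :
  (forall l, exists i, B i (w l)) -> exists i, forall l, B i (w l).
Proof.
elim: k w => [|k IH] w wB; first by exists i0 => -[].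
have [i Bi] := IH (fun l => w (widen_ord (leqnSn k) l)) (fun l => wB _).
have [j Bj] := wB ord_max.
have [m [Bim Bjm]] := Bdir i j; exists m => l.
case: (ltnP l k) => [lk|kl].
  apply: Bim; have -> // : l = widen_ord (leqnSn k) (Ordinal lk) by apply: val_inj.
apply: Bjm; have -> // : l = ord_max.
by apply: val_inj => /=; apply/eqP; rewrite eqn_leq kl -ltnS ltn_ord.
Qed.

Lemma lspan_directed_bigcup (F : fieldType) (U : lmodType F) (I : Type) (i0 : I)
    (B : I -> set U)
    (Bdir : forall i j, exists k, B i `<=` B k /\ B j `<=` B k) u :
  lspan [set w | exists i, B i w] u -> exists i, lspan (B i) u.
Proof.
move=> [k [c [w [Bw ->]]]]; have [i Bi] := directed_bigcup_finite i0 Bdir Bw.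
by exists i, k, c, w.
Qed.

(** * Operator norms through sums of squares, and the Cauchy-Schwarz inequality *)

Section OperatorNorm.
Variable R : realType.
Local Notation "x %:C" := (real_complex R x) (format "x %:C").

Definition rnorm (H : normedZmodType R[i]) (x : H) : R := complex.Re `|x|.

Lemma rnormE (H : normedZmodType R[i]) (x : H) : `|x| = (rnorm x)%:C.
Proof. by rewrite /rnorm RRe_real ?normr_real. Qed.

Lemma rnorm_ge0 (H : normedZmodType R[i]) (x : H) : 0 <= rnorm x.
Proof. by rewrite -lecR -rnormE normr_ge0. Qed.

Lemma rnorm_eq0 (H : normedZmodType R[i]) (x : H) : rnorm x = 0 -> x = 0.
Proof.
by move=> x0; apply/eqP; rewrite -normr_eq0 rnormE x0.
Qed.

Lemma rnormD (H : normedZmodType R[i]) (x y : H) : rnorm (x + y) <= rnorm x + rnorm y.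
Proof. by rewrite -lecR rmorphD /= -!rnormE ler_normD. Qed.

Lemma rnormZ (H : normedModType R[i]) (a : R[i]) (x : H) :
  rnorm (a *: x) = rnorm a * rnorm x.
Proof. by apply: complexI; rewrite rmorphM /= -!rnormE normrZ. Qed.

Lemma rnormM (a b : R[i]) : rnorm (a * b) = rnorm a * rnorm b.
Proof. by apply: complexI; rewrite rmorphM /= -!rnormE normrM. Qed.

Lemma rnorm_real (a : R) : rnorm a%:C = `|a|.
Proof.
apply: complexI; rewrite -rnormE normc_def /= expr0n addr0.
by rewrite sqrtr_sqr.
Qed.

(** Working with the square of [l2norm] keeps square roots out of the estimates until an [opnorm] is
    involved. *)
Definition sqnorm n (H : normedZmodType R[i]) (v : 'I_n -> H) : R :=
  \sum_i rnorm (v i) ^+ 2.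

Lemma l2normE n (H : normedZmodType R[i]) (v : 'I_n -> H) :
  l2norm v = Num.sqrt (sqnorm v).
Proof. by []. Qed.

Lemma sqnorm_ge0 n (H : normedZmodType R[i]) (v : 'I_n -> H) : 0 <= sqnorm v.
Proof. by apply: sumr_ge0 => i _; apply: sqr_ge0. Qed.

Lemma sqnorm_eq0 n (H : normedZmodType R[i]) (v : 'I_n -> H) :
  sqnorm v = 0 -> forall i, v i = 0.
Proof.
move=> /psumr_eq0P v0 i; apply: rnorm_eq0; apply/eqP.
by rewrite -sqrf_eq0 v0// => j _; apply: sqr_ge0.
Qed.

Lemma sqnormZ n (H : normedModType R[i]) (a : R[i]) (v : 'I_n -> H) :
  sqnorm (fun i => a *: v i) = rnorm a ^+ 2 * sqnorm v.
Proof. by rewrite mulr_sumr; apply: eq_bigr => i _; rewrite rnormZ exprMn. Qed.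

Lemma sqnormM n (a : R[i]) (v : 'I_n -> R[i]) :
  sqnorm (fun i => a * v i) = rnorm a ^+ 2 * sqnorm v.
Proof. by rewrite mulr_sumr; apply: eq_bigr => i _; rewrite rnormM exprMn. Qed.

(** A crude form of the triangle inequality. It serves to show that a sum of bounded polynomials is
    bounded, where the factor 2 is harmless. *)
Lemma sqnormD n (H : normedZmodType R[i]) (u v : 'I_n -> H) :
  sqnorm (fun i => u i + v i) <= 2 * (sqnorm u + sqnorm v).
Proof.
rewrite /sqnorm -big_split mulr_sumr; apply: ler_sum => i _ /=.
apply: (@le_trans _ _ ((rnorm (u i) + rnorm (v i)) ^+ 2)).
  by rewrite ler_sqr ?nnegrE ?addr_ge0 ?rnorm_ge0 ?rnormD.
have := sqr_ge0 (rnorm (u i) - rnorm (v i)); nra.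
Qed.

Lemma sqnorm_split n m (H : normedZmodType R[i]) (v : 'I_(n + m) -> H) :
  sqnorm v = sqnorm (v \o lshift m) + sqnorm (v \o @rshift n m).
Proof. by rewrite /sqnorm big_split_ord. Qed.

Lemma opnorm_le n m (H K : normedZmodType R[i]) (T : ('I_n -> H) -> ('I_m -> K)) M :
    0 <= M -> (forall v, sqnorm (T v) <= M * sqnorm v) ->
  (opnorm T <= (Num.sqrt M)%:E)%E.
Proof.
move=> M0 TM; apply: ge_ereal_sup => _ [v v1 <-].
rewrite lee_fin !l2normE; apply: ler_wsqrtr; apply: le_trans (TM v) _.
by rewrite ler_piMr// -(@ler_sqrt _ _ 1) ?ler01// sqrtr1.
Qed.

(** Homogeneity carries a bound from the unit ball to all vectors; the factor [r] is the square of
    the operator norm. *)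
Lemma opnorm_lt1P n m (H K : normedModType R[i]) (T : ('I_n -> H) -> ('I_m -> K)) :
    (forall (a : R[i]) v, T (fun i => a *: v i) = fun i => a *: T v i) ->
  (opnorm T < 1%:E)%E <->
  exists r, [/\ 0 <= r, r < 1 & forall v, sqnorm (T v) <= r * sqnorm v].
Proof.
move=> TZ; split=> [|[r [r0 r1 Tr]]]; last first.
  apply: (le_lt_trans (opnorm_le r0 Tr)).
  by rewrite lte_fin -sqrtr1 ltr_sqrt.
have le_op v : l2norm v <= 1 -> ((l2norm (T v))%:E <= opnorm T)%E.
  by move=> v1; apply: ereal_sup_ubound; exists v.
(* The zero vector shows that the supremum is not [-oo]; with the bound by 1 it is then a real s in
   [0, 1). *)
have : ((0 : R)%:E <= opnorm T)%E.
  apply: le_trans (le_op (fun=> 0) _); first by rewrite lee_fin sqrtr_ge0.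
  rewrite l2normE /sqnorm big1 ?sqrtr0 ?ler01// => i _.
  by rewrite /rnorm normr0 expr0n.
case: (opnorm T) le_op => [s|//|//] le_op; rewrite lee_fin lte_fin => s0 s1.
exists (s ^+ 2); split=> [||v]; first exact: sqr_ge0.
  by rewrite expr_lt1.
(* A vector of length 0 cannot be normalized, but it equals [0 *: v], so homogeneity applies with
   the scalar 0. *)
have [v0|v0] := eqVneq (sqnorm v) 0.
  have -> : v = fun i => 0 *: v i.
    by apply/funext => i; rewrite scale0r (sqnorm_eq0 v0).
  by rewrite TZ !sqnormZ /rnorm normr0 expr0n/= !mul0r mulr0.
have vgt0 : 0 < sqnorm v by rewrite lt_def v0 sqnorm_ge0.
pose a := (Num.sqrt (sqnorm v))^-1.
have a2 : rnorm a%:C ^+ 2 = (sqnorm v)^-1.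
  by rewrite rnorm_real real_normK ?num_real// exprVn sqr_sqrtr// ltW.
have := le_op (fun i => a%:C *: v i).
rewrite !l2normE TZ !sqnormZ a2 mulVf// sqrtr1 => /(_ (lexx _)).
rewrite lee_fin => le_s.
have : Num.sqrt ((sqnorm v)^-1 * sqnorm (T v)) ^+ 2 <= s ^+ 2.
  by rewrite ler_sqr ?nnegrE ?sqrtr_ge0.
rewrite sqr_sqrtr; last by rewrite mulr_ge0 ?invr_ge0 ?sqnorm_ge0.
by rewrite mulrC ler_pdivrMr.
Qed.

(* The CauchySchwarz of the library is restricted to finite dimensions. *)
Lemma hilbert_cauchy_schwarz (H : hilbertType R) (x y : H) :
  rnorm (hdot H x y) ^+ 2 <= rnorm x ^+ 2 * rnorm y ^+ 2.
Proof.
rewrite -lecR -exprMn !rmorphXn rmorphM exprMn /= -!rnormE !hnormE normCK.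
have [->|y0] := eqVneq y 0.
  by rewrite !linear0r mul0r.
set p := hdot H x y; set b := hdot H y y.
have b0 : 0 < b by apply: neq0_dnorm_gt0.
have bC : b^* = b by apply/CrealP; apply: ger0_real; apply: ltW.
(* This vector is b times the component of x orthogonal to y; its squared norm is b (<x, x> b -
   |p|^2). *)
have := dnorm_ge0 (hdot H) (b *: x - p *: y).
rewrite dnormB !dnormZ linearZl_LR linearZr_LR /= -/p -/b.
rewrite !rmorphM /= conjCK bC !normCK bC mulrA.
have -> : b * b * hdot H x x + p * p^* * b - (b * p^* * p + b * (p * p^*)) =
  b * (hdot H x x * b - p * p^*) by ring.
by rewrite pmulr_rge0// subr_ge0.
Qed.

End OperatorNorm.

(** * The operator ball and its subvarieties are closed under direct sums *)

Section OperatorBall.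
Variables (R : realType) (d : nat) (H K : hilbertType R).
Variable Q : 'I_d -> {linear H -> K}.

Lemma pencilZ n (X : mtuple R d n) (a : R[i]) (v : 'I_n -> H) :
  pencil Q X (fun i => a *: v i) = fun i => a *: pencil Q X v i.
Proof.
apply/funext => i; rewrite /pencil scaler_sumr; apply: eq_bigr => j _.
rewrite scaler_sumr; apply: eq_bigr => k _.
by rewrite linearZ_LR /= !scalerA mulrC.
Qed.

Lemma nc_ballP n (X : mtuple R d n) :
  nc_ball Q X <-> (0 < n)%N /\
    exists r, [/\ 0 <= r, r < 1 & forall v, sqnorm (pencil Q X v) <= r * sqnorm v].
Proof.
rewrite /nc_ball /=; split=> -[n0 QX]; split=> //.
  by apply/opnorm_lt1P => // a v; apply: pencilZ.
by apply/opnorm_lt1P => // a v; apply: pencilZ.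
Qed.

Lemma pencil_dsuml n m (X : mtuple R d n) (Y : mtuple R d m) v i :
  pencil Q (nc_dsum X Y) v (lshift m i) = pencil Q X (v \o lshift m) i.
Proof.
apply: eq_bigr => j _; rewrite big_split_ord /= [X in _ + X]big1 ?addr0.
  by apply: eq_bigr => k _; rewrite ffunE block_mxEul.
by move=> k _; rewrite ffunE block_mxEur mxE scale0r.
Qed.

Lemma pencil_dsumr n m (X : mtuple R d n) (Y : mtuple R d m) v i :
  pencil Q (nc_dsum X Y) v (rshift n i) = pencil Q Y (v \o @rshift n m) i.
Proof.
apply: eq_bigr => j _; rewrite big_split_ord /= [X in X + _]big1 ?add0r.
  by apply: eq_bigr => k _; rewrite ffunE block_mxEdr.
by move=> k _; rewrite ffunE block_mxEdl mxE scale0r.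
Qed.

(** The pencil of a direct sum acts separately on the two blocks of a vector, so the larger of the
    two contraction factors works. *)
Lemma nc_ball_dsum n m (X : mtuple R d n) (Y : mtuple R d m) :
  nc_ball Q X -> nc_ball Q Y -> nc_ball Q (nc_dsum X Y).
Proof.
move=> /nc_ballP[n0 [r [r0 r1 Xr]]] /nc_ballP[m0 [s [s0 s1 Ys]]].
apply/nc_ballP; split; first by rewrite addn_gt0 n0.
exists (Num.max r s); split=> [||v]; first by rewrite le_max r0.
  by rewrite gt_max r1.
rewrite !sqnorm_split mulrDr; apply: lerD.
  have -> : pencil Q (nc_dsum X Y) v \o lshift m = pencil Q X (v \o lshift m).
    by apply/funext => i /=; apply: pencil_dsuml.
  by apply: le_trans (Xr _) _; rewrite ler_wpM2r ?sqnorm_ge0// le_max lexx.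
have -> : pencil Q (nc_dsum X Y) v \o @rshift n m = pencil Q Y (v \o @rshift n m).
  by apply/funext => i /=; apply: pencil_dsumr.
by apply: le_trans (Ys _) _; rewrite ler_wpM2r ?sqnorm_ge0// le_max lexx orbT.
Qed.

Lemma nc_subvariety_dsum (V : ncset R d) n m (X : mtuple R d n) (Y : mtuple R d m) :
  nc_subvariety (nc_ball Q) V -> V n X -> V m Y -> V (n + m)%N (nc_dsum X Y).
Proof.
move=> [S SH VE]; rewrite !VE => -[BX SX] [BY SY]; split; first exact: nc_ball_dsum.
move=> f Sf; have [[fD _] _] := SH f Sf.
by rewrite fD// SX// SY// block_mx_const.
Qed.

(** * Linear polynomials as bounded nc functions on the ball *)

Lemma nc_function_linear_poly (Omega : ncset R d) (c : 'rV_d) :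
  nc_function Omega (nc_linear_poly c).
Proof.
split=> [n m X Y _ _|n S X _ _ _].
  rewrite /nc_linear_poly; elim/big_rec3: _ => [|j A B C _ ->].
    by rewrite block_mx_const.
  by rewrite ffunE scale_block_mx add_block_mx !scaler0 !addr0.
rewrite /nc_linear_poly mulmx_sumr mulmx_suml; apply: eq_bigr => j _.
by rewrite ffunE -scalemxAr -scalemxAl.
Qed.

(** One constant serves all levels n. The coefficient vectors with this property form a subspace of
    C^d, so boundedness need only be checked on a spanning set. *)
Definition bounded_linear_poly (c : 'rV[R[i]]_d) := exists M : R, 0 <= M /\
  forall n (X : mtuple R d n), nc_ball Q X -> forall v : 'I_n -> R[i],
    sqnorm (fun i => \sum_k nc_linear_poly c X i k * v k) <= M * sqnorm v.

(** Applying the polynomial at X to v amounts to pairing Q(X)(u (x) v) with y. Cauchy-Schwarz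
    contributes |y|, the contraction Q(X) at most 1, and u (x) v has norm |u| |v|. *)
Lemma bounded_linear_poly_dot (u : H) (y : K) :
  bounded_linear_poly (\row_j hdot K (Q j u) y).
Proof.
exists (rnorm y ^+ 2 * rnorm u ^+ 2).
split=> [|n X /nc_ballP[_ [r [r0 r1 Xr]]] v]; first by rewrite mulr_ge0 ?sqr_ge0.
have E i : \sum_k nc_linear_poly (\row_j hdot K (Q j u) y) X i k * v k =
    hdot K (pencil Q X (fun k => v k *: u) i) y.
  rewrite /pencil linear_sumlz /=.
  under eq_bigr do rewrite summxE mulr_suml.
  rewrite exchange_big /=; apply: eq_bigr => j _.
  rewrite linear_sumlz; apply: eq_bigr => k _.
  by rewrite linearZl_LR linearZ_LR /= linearZl_LR /= !mxE; ring.
apply: (@le_trans _ _ (rnorm y ^+ 2 * sqnorm (pencil Q X (fun k => v k *: u)))).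
  rewrite [leRHS]mulr_sumr; apply: ler_sum => i _.
  by rewrite E mulrC hilbert_cauchy_schwarz.
rewrite -mulrA ler_wpM2l ?sqr_ge0//; apply: le_trans (Xr _) _.
apply: (@le_trans _ _ (sqnorm (fun k => v k *: u))).
  by rewrite ler_piMl ?sqnorm_ge0// ltW.
by rewrite /sqnorm mulr_sumr; apply: ler_sum => k _; rewrite rnormZ exprMn mulrC.
Qed.

Lemma bounded_linear_polyD c b :
  bounded_linear_poly c -> bounded_linear_poly b -> bounded_linear_poly (c + b).
Proof.
move=> [M [M0 cM]] [N [N0 bN]]; exists (2 * (M + N)).
split=> [|n X BX v]; first by rewrite mulr_ge0 ?addr_ge0.
have -> : (fun i => \sum_k nc_linear_poly (c + b) X i k * v k) =
  fun i => \sum_k nc_linear_poly c X i k * v k + \sum_k nc_linear_poly b X i k * v k.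
  apply/funext => i; rewrite -big_split; apply: eq_bigr => k _ /=.
  rewrite -mulrDl !summxE -big_split; congr (_ * _); apply: eq_bigr => j _ /=.
  by rewrite !mxE mulrDl.
apply: le_trans (sqnormD _ _) _; rewrite -mulrA ler_wpM2l// mulrDl.
by apply: lerD; [apply: cM|apply: bN].
Qed.

Lemma bounded_linear_polyZ a c : bounded_linear_poly c -> bounded_linear_poly (a *: c).
Proof.
move=> [M [M0 cM]]; exists (rnorm a ^+ 2 * M).
split=> [|n X BX v]; first by rewrite mulr_ge0 ?sqr_ge0.
have -> : (fun i => \sum_k nc_linear_poly (a *: c) X i k * v k) =
  fun i => a * \sum_k nc_linear_poly c X i k * v k.
  apply/funext => i; rewrite mulr_sumr; apply: eq_bigr => k _ /=.
  rewrite mulrA !summxE mulr_sumr; congr (_ * _); apply: eq_bigr => j _ /=.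
  by rewrite !mxE mulrA.
by rewrite sqnormM -mulrA ler_wpM2l ?sqr_ge0// cM.
Qed.

Lemma bounded_linear_poly0 : bounded_linear_poly 0.
Proof.
exists 0; split=> // n X _ v; rewrite mul0r /sqnorm big1// => i _.
rewrite big1 ?/rnorm ?normr0 ?expr0n// => k _.
by rewrite summxE big1 ?mul0r// => j _; rewrite !mxE mul0r.
Qed.

Lemma bounded_linear_poly_free (c : 'rV_d) : operators_free Q -> bounded_linear_poly c.
Proof.
move=> Qfree.
pose A := [set w : 'rV[R[i]]_d | exists u y, w = \row_j hdot K (Q j u) y].
have : lspan A c.
  rewrite lspan_rV_full// => b Ab; apply: Qfree => u.
  (* For z = sum_j b_j Q_j u, testing the annihilator b on the vector given by u and y = z yields
     <z, z> = 0. *)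
  set z := \sum_j _; apply/eqP; rewrite -(dnorm_eq0 (hdot K)); apply/eqP.
  rewrite {1}/z linear_sumlz.
  rewrite -[RHS](Ab (\row_j hdot K (Q j u) z)); last by exists u, z.
  by apply: eq_bigr => j _; rewrite mxE linearZl_LR.
apply: lspan_ind => //; first exact: bounded_linear_poly0.
- by move=> *; apply: bounded_linear_polyD.
- by move=> *; apply: bounded_linear_polyZ.
- by move=> _ [u [y ->]]; apply: bounded_linear_poly_dot.
Qed.

Lemma nc_linear_poly_Hinfty (c : 'rV_d) :
  operators_free Q -> nc_Hinfty (nc_ball Q) (nc_linear_poly c).
Proof.
move=> /(bounded_linear_poly_free c)[M [M0 cM]]; split; first exact: nc_function_linear_poly.
by exists (Num.sqrt M) => n X BX; apply: opnorm_le => // v; apply: cM.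
Qed.

End OperatorBall.

(** * Matrix spans and the vectors of matrix entries *)

Section MatrixSpan.
Variables (R : realType) (d : nat) (V : ncset R d).

(** A linear map T on M_n commutes with the combination sum_j c_j X_j, so vanishing at X passes to
    (T(X_j))_j and then to the span. *)
Lemma mat_span_annihilator n (c : 'rV_d) (Y : mtuple R d n) :
    (forall X : mtuple R d n, V X -> nc_linear_poly c X = 0) -> mat_span V Y ->
  nc_linear_poly c Y = 0.
Proof.
move=> cV; apply: (@lspan_ind _ _ _ (fun Y => nc_linear_poly c Y = 0)).
- by rewrite /nc_linear_poly big1// => j _; rewrite ffunE scaler0.
- move=> X Z cX cZ; rewrite -[RHS]addr0 -{1}cX -cZ -big_split.
  by apply: eq_bigr => j _; rewrite ffunE scalerDr.
- move=> a X cX; rewrite -[RHS](scaler0 _ a) -cX scaler_sumr.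
  by apply: eq_bigr => j _; rewrite ffunE !scalerA mulrC.
- move=> _ [X [T [VX ->]]]; rewrite -[RHS](linear0 T) -(cV X VX) linear_sum.
  by apply: eq_bigr => j _; rewrite ffunE linearZ_LR.
Qed.

(** The set A_n of the introduction. *)
Definition entry_vectors n : set 'rV[R[i]]_d :=
  [set w | exists (X : mtuple R d n) a b, V X /\ w = \row_j X j a b].

(** The map T(M) = M_ab B sends X to w (x) B, where w is the vector of the (a,b) entries of X. By
    linearity in w all elementary tensors are reached, and Y is the sum of the tensors e_k (x)
    Y_k. *)
Lemma mat_span_entry_vectors n :
  lspan (entry_vectors n) = setT -> @mat_span R d V n = setT.
Proof.
move=> full; apply/seteqP; split=> // Y _.
have tens (w : 'rV_d) (B : 'M[R[i]]_n) : mat_span V [ffun j => w 0 j *: B].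
  have : lspan (entry_vectors n) w by rewrite full.
  apply: (@lspan_ind _ _ _ (fun w : 'rV[R[i]]_d => mat_span V [ffun j => w 0 j *: B])).
  - suff -> : [ffun j => (0 : 'rV[R[i]]_d) 0 j *: B] = 0 by apply: lspan0.
    by apply/ffunP => j; rewrite !ffunE mxE scale0r.
  - move=> u v Bu Bv; suff -> : [ffun j => (u + v) 0 j *: B] =
        [ffun j => u 0 j *: B] + [ffun j => v 0 j *: B] by apply: lspanD.
    by apply/ffunP => j; rewrite !ffunE mxE scalerDl.
  - move=> a u Bu; suff -> : [ffun j => (a *: u) 0 j *: B] =
        a *: [ffun j => u 0 j *: B] by apply: lspanZ.
    by apply/ffunP => j; rewrite !ffunE mxE scalerA.
  - move=> _ [X [a [b [VX ->]]]]; apply: sub_lspan.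
    have Tlin : linear (fun M : 'M[R[i]]_n => M a b *: B).
      by move=> x M N; rewrite !mxE scalerDl scalerA.
    pose T : {linear 'M[R[i]]_n -> 'M[R[i]]_n} :=
      HB.pack (fun M : 'M[R[i]]_n => M a b *: B)
        (GRing.isLinear.Build _ _ _ _ _ Tlin).
    by exists X, T; split=> //; apply/ffunP => j; rewrite !ffunE mxE.
suff -> : Y = \sum_k [ffun j => (delta_mx 0 k : 'rV[R[i]]_d) 0 j *: Y k].
  by apply: lspan_sum => k _; apply: tens.
apply/ffunP => j; rewrite sum_ffunE (bigD1 j)//= ffunE mxE !eqxx scale1r.
rewrite big1 ?addr0// => k kj; rewrite ffunE mxE eqxx eq_sym.
by rewrite (negbTE kj) scale0r.
Qed.

(** The entries of Z reappear in a diagonal block once Z is padded by a point of the other level,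
    whence the nonemptiness hypotheses. *)
Lemma entry_vectors_dsum n m :
  (forall (X : mtuple R d n) (Y : mtuple R d m),
     V X -> V Y -> V (nc_dsum X Y)) ->
  @V n !=set0 -> @V m !=set0 ->
  entry_vectors n `<=` entry_vectors (n + m) /\
  entry_vectors m `<=` entry_vectors (n + m).
Proof.
move=> VD [X0 VX0] [Y0 VY0]; split=> w [Z [a [b [VZ ->]]]].
  exists (nc_dsum Z Y0), (lshift m a), (lshift m b); split; first exact: VD.
  by apply/rowP => j; rewrite !mxE ffunE block_mxEul.
exists (nc_dsum X0 Z), (rshift n a), (rshift n b); split; first exact: VD.
by apply/rowP => j; rewrite !mxE ffunE block_mxEdr.
Qed.

Lemma entry_vectors_directed n m :
  (forall k l (X : mtuple R d k) (Y : mtuple R d l),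
     V X -> V Y -> V (nc_dsum X Y)) ->
  exists k, entry_vectors n.+1 `<=` entry_vectors k.+1 /\
            entry_vectors m.+1 `<=` entry_vectors k.+1.
Proof.
move=> VD.
(* An empty level has no entry vectors, so the other level can serve as upper bound. *)
have [Vn|/set0P Vn] := eqVneq (@V n.+1) set0.
  by exists m; split=> // w [X [a [b []]]]; rewrite Vn.
have [Vm|/set0P Vm] := eqVneq (@V m.+1) set0.
  by exists n; split=> // w [X [a [b []]]]; rewrite Vm.
(* The successor of this index is n.+1 + m.+1 by computation. *)
by exists (n + m.+1)%N; apply: entry_vectors_dsum => // X Y; apply: VD.
Qed.

End MatrixSpan.

(** * Both implications of the equivalence *)

Theorem theorem6p14 (R : realType) (d : nat) (H K : hilbertType R)
    (Q : 'I_d -> {linear H -> K})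
    (Qcont : forall j, continuous (Q j : H -> K))
    (Qfree : operators_free Q)
    (V : ncset R d) (hV : nc_subvariety (nc_ball Q) V) :
  matrix_spanning V <->
  ~ (exists2 c : 'rV[R[i]]_d, c != 0 & nc_ideal (nc_ball Q) V (nc_linear_poly c)).
Proof.
have VD k l (X : mtuple R d k) (Y : mtuple R d l) :
    V k X -> V l Y -> V (k + l)%N (nc_dsum X Y).
  exact: nc_subvariety_dsum hV.
split=> [[n n0 Vfull] [c c0 [_ cV]]|noc].
  case: n n0 Vfull => // n _ Vfull.
  have [j cj0] : exists j, c 0 j != 0 by apply/rV0Pn.
  (* With the identity in slot j and 0 elsewhere, the polynomial takes the value c_j I, whose (0,0)
     entry is nonzero. *)
  pose Y : mtuple R d n.+1 := [ffun k => (k == j)%:R%:M].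
  have := mat_span_annihilator (V := V) (c := c) (Y := Y) (cV n.+1).
  rewrite Vfull => /(_ I) /matrixP /(_ 0 0).
  rewrite summxE (bigD1 j)//= big1 => [|k kj].
    by rewrite addr0 mxE ffunE eqxx !mxE eqxx mulr1 => /eqP; rewrite (negbTE cj0).
  by rewrite mxE ffunE (negbTE kj) !mxE mul0rn mulr0.
(* A nonzero c killing all entry vectors would give a polynomial vanishing on V entry by entry,
   hence lying in the ideal. *)
have full w : lspan [set w | exists n, entry_vectors V n.+1 w] w.
  rewrite lspan_rV_full// => c cA; apply/eqP; apply: contra_notT noc => c0.
  exists c => //; split=> [|n X VX]; first exact: nc_linear_poly_Hinfty.
  have n0 : (0 < n)%N.
    by case: hV => S _ VE; move: VX; rewrite VE => -[[]].
  case: n n0 X VX => // n _ X VX; apply/matrixP => a b; rewrite summxE mxE.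
  rewrite -[RHS](cA (\row_j X j a b)); last by exists n, X, a, b.
  by apply: eq_bigr => j _; rewrite !mxE.
have dir n m := entry_vectors_directed n m VD.
(* Directedness passes to the spans, so a single level captures all d standard basis vectors. *)
have sdir n m : exists k,
    lspan (entry_vectors V n.+1) `<=` lspan (entry_vectors V k.+1) /\
    lspan (entry_vectors V m.+1) `<=` lspan (entry_vectors V k.+1).
  have [k [nk mk]] := dir n m; exists k.
  by split; apply: lspanS => w; [move/nk|move/mk]; apply: sub_lspan.
have [n nfull] : exists n, forall j : 'I_d,
    lspan (entry_vectors V n.+1) (delta_mx 0 j).
  apply: (directed_bigcup_finite 0%N sdir) => j.
  exact: (@lspan_directed_bigcup _ _ _ 0%N (fun n => entry_vectors V n.+1)).
exists n.+1 => //; apply: mat_span_entry_vectors.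
apply/seteqP; split=> // w _; rewrite (row_sum_delta w).
by apply: lspan_sum => j _; apply: lspanZ.
Qed.
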